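(* Let $(\Omega,\mathcal S,\mu)$ be a measure space, let $m\ge 1$, and for each $j\le m$ let $(M_j,\mathcal M_j,\nu_j)$ be a measure space together with a measurable function $p_j:\Omega\to M_j$. Let $c_1,\dots,c_m$ be nonnegative numbers and let $D\in\mathbb R$ be such that the following two (equivalent) inequalities hold: the Brascamp--Lieb inequality, written for the functions $f_j^{c_j}$, $$\int_\Omega\prod_{j=1}^m \big(f_j(p_j(x))\big)^{c_j}\,d\mu(x)\le e^D\prod_{j=1}^m\left(\int_{M_j}f_j(t)\,d\nu_j(t)\right)^{c_j}\qquad\text{for all nonnegative functions } f_j:M_j\to\mathbb R_+,\ j\le m,\tag{BL}$$ and the subadditivity inequality $$\sum_{j=1}^m c_j\,S(f_{(p_j)})\le S(f)+D\qquad\text{for every probability density } f \text{ on }\Omega\text{ with finite entropy}.\tag{S}$$ (i) Suppose that $f$ is a probability density on $\Omega$ for which equality holds in (S). Then the marginals $f_{(p_1)},\dots,f_{(p_m)}$ of $f$ yield equality in (BL) (taking $f_j=f_{(p_j)}$), and moreover $f$ and its marginals satisfy $$f(x)=e^{-D}\prod_{j=1}^m\big(f_{(p_j)}(p_j(x))\big)^{c_j}.$$ (ii) Conversely, suppose that $f_1,\dots,f_m$ are probability densities (on $M_j$ with respect to $\nu_j$, for $j=1,\dots,m$ respectively) for which equality holds in (BL). Then the probability density $f$ defined on $\Omega$ by $$f(x):=e^{-D}\prod_{j=1}^m\big(f_j(p_j(x))\big)^{c_j}$$ yields equality in (S), and moreover $f_j$ is the $j$-th marginal of $f$, i.e. $f_j=f_{(p_j)}$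 for $j\le m$.
   Context: A probability density on a measure space $(\Omega,\mathcal S,\mu)$ is a nonnegative integrable function $f$ with $\int_\Omega f\,d\mu=1$. It has finite entropy if $\int_\Omega f\ln(1+f)\,d\mu<\infty$, and its entropy is $S(f)=\int_\Omega f\ln f\,d\mu$ (note the sign convention); entropies of densities on $(M_j,\nu_j)$ are defined in the same way with respect to $\nu_j$. Marginals: $f_{(p_j)}$ is the probability density on $M_j$ (with respect to $\nu_j$) such that $\int_\Omega \phi(p_j(x))f(x)\,d\mu(x)=\int_{M_j}\phi(t)f_{(p_j)}(t)\,d\nu_j(t)$ for all bounded measurable functions $\phi$ on $M_j$; that is, $f_{(p_j)}\,d\nu_j$ is the push-forward of $f\,d\mu$ under $p_j$.
   Formalization: In (i), S(f) is assumed not to be -∞; in (ii), f_j is shown to be the j-th marginal only when c_j > 0, and equality in (S) is claimed when the f_j with c_j > 0 have finite entropy. The identity in (i) is μ-a.e.; without these conditions the text is false or undefined. *)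

(* Defs.v *)
From HB Require Import structures.
From mathcomp Require Import all_boot all_order all_algebra.
From mathcomp Require Import all_classical all_reals all_analysis.

Set Implicit Arguments.
Unset Strict Implicit.
Unset Printing Implicit Defensive.

Import Order.TTheory GRing.Theory Num.Theory.
Import numFieldNormedType.Exports.

Local Open Scope classical_set_scope.
Local Open Scope ring_scope.

Definition is_density (R : realType) (d : measure_display)
    (T : measurableType d) (mu : {measure set T -> \bar R}) (f : T -> R) : Prop :=
  [/\ forall x, 0 <= f x,
      mu.-integrable setT (EFin \o f) &
      (\int[mu]_x (f x)%:E = 1)%E].

Definition finite_entropy (R : realType) (d : measure_display)
    (T : measurableType d) (mu : {measure set T -> \bar R}) (f : T -> R) : Prop :=
  (\int[mu]_x (f x * ln (1 + f x))%:E < +oo)%E.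

(* Where [f = 0] the integrand is 0.  For a density
   with finite entropy the value is in [-oo, +oo); it is -oo exactly when
   [f ln f] is not integrable. *)
Definition entropy (R : realType) (d : measure_display)
    (T : measurableType d) (mu : {measure set T -> \bar R}) (f : T -> R) : \bar R :=
  \int[mu]_x (f x * ln (f x))%:E.

(* [g] is (a version of) the density [f_(p)]: it is determined by [f] up to
   equality [nu]-almost everywhere. *)
Definition is_marginal (R : realType) (d d' : measure_display)
    (T : measurableType d) (M : measurableType d')
    (mu : {measure set T -> \bar R}) (nu : {measure set M -> \bar R})
    (p : T -> M) (f : T -> R) (g : M -> R) : Prop :=
  is_density nu g /\
  forall phi : M -> R, measurable_fun setT phi -> bounded_fun phi ->
    (\int[mu]_x (phi (p x) * f x)%:E = \int[nu]_t (phi t * g t)%:E)%E.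

Section BrascampLieb.
Variables (R : realType) (d : measure_display) (Omega : measurableType d).
Variables (mu : {measure set Omega -> \bar R}).
Variables (m : nat) (dM : 'I_m -> measure_display).
Variables (M : forall j : 'I_m, measurableType (dM j)).
Variables (nu : forall j : 'I_m, {measure set (M j) -> \bar R}).
Variables (p : forall j : 'I_m, Omega -> M j).
Variables (c : 'I_m -> R) (D : R).

Definition bl_prod (f : forall j, M j -> R) (x : Omega) : R :=
  \prod_(j < m) (f j (p j x)) `^ (c j).

Definition bl_lhs (f : forall j, M j -> R) : \bar R :=
  \int[mu]_x (bl_prod f x)%:E.

(* [0 * +oo = 0] and [(+oo) `^ 0 = 1]. *)
Definition bl_rhs (f : forall j, M j -> R) : \bar R :=
  ((expR D)%:E * \prod_(j < m) (\int[nu j]_t (f j t)%:E) `^ (c j))%E.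

Definition brascamp_lieb : Prop :=
  forall f : forall j, M j -> R,
    (forall j, measurable_fun setT (f j)) ->
    (forall j t, 0 <= f j t) ->
    (bl_lhs f <= bl_rhs f)%E.

Definition weighted_entropy (g : forall j, M j -> R) : \bar R :=
  (\sum_(j < m) (c j)%:E * entropy (nu j) (g j))%E.

(* Where [-oo] and [+oo] both occur in the sum, or in the integral defining an
   entropy, the library value is [-oo]: such an [f] is not constrained. *)
Definition subadditivity : Prop :=
  forall (f : Omega -> R) (g : forall j, M j -> R),
    is_density mu f -> finite_entropy mu f ->
    (forall j, is_marginal mu (nu j) (p j) f (g j)) ->
    (weighted_entropy g <= entropy mu f + D%:E)%E.

End BrascampLieb.

(* Main.v *)
Require Import Defs.
From HB Require Import structures.
From mathcomp Require Import all_boot all_order all_algebra.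
From mathcomp Require Import all_classical all_reals all_analysis.
From mathcomp Require Import measurable_realfun ring lra.
Import Order.TTheory GRing.Theory Num.Theory.
Import numFieldNormedType.Exports.
Local Open Scope classical_set_scope.
Local Open Scope ring_scope.

Set Implicit Arguments.
Unset Strict Implicit.
Unset Printing Implicit Defensive.

(** For (i), put [h = e^-D prod_j g_j(p_j)^(c_j)].  By (BL) [h] has mass at most
    1, while equality in (S) says that [f ln (f/h)] integrates to 0; by Gibbs'
    inequality [f ln (f/h) - f + h >= 0], with equality only where [f = h], so
    [f = h] almost everywhere and [h] has mass 1.
    For (ii), replace [f_j] by [e^(t phi) f_j] in (BL): the inequality is an
    equality at [t = 0], and comparing the first-order terms there gives
    [int phi(p_j) f = int phi f_j].  Equality in (S) follows by integrating
    [ln f = - D + sum_j c_j ln f_j(p_j)] against [f]. *)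

(** Two obstacles shape the proof. Entropies can be [-oo]: a density with finite entropy only has
    the positive part of [f ln f] under control. In (i) the finiteness of [entropy mu f] passes
    through the equality to every term of the sum, after which all integrals are real numbers. In
    (ii) both sides may be [-oo], so additivity and homogeneity of the integral are needed under
    finiteness of the positive parts alone. The first-order comparison in (ii) uses no
    differentiation under the integral. The tilted left side is bounded below by [1 + y <= expR y],
    the right side above by [expR y <= 1 + y + 2 y^2] for [y <= 1/2]; this yields
    [A t <= B t + L t^2] for all small [t > 0], hence [A <= B], and [- phi] gives the converse. The
    inequality is obtained with a factor [c j] on both sides, so it identifies the marginal only
    when [c j > 0]. *)

(** * Elementary inequalities for real numbers *)

Lemma bounded_fun_le {R : realType} {T : Type} (phi : T -> R) :
  bounded_fun phi <-> exists K, forall x, `|phi x| <= K.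
Proof.
split=> [[K [_ hK]]|[K hK]].
  by exists (K + 1) => x; apply: hK => //; rewrite ltrDl.
exists K; split; first exact: num_real.
by move=> N KN x _; apply: le_trans (hK x) _; exact: ltW.
Qed.

(** Since [1 - y <= expR (- y)], it is enough that [(1 - y)(1 + y + 2 y^2) = 1 + y^2 (1 - 2 y)] is
    at least 1. *)
Lemma expR_le_quadratic {R : realType} (y : R) :
  y <= 2^-1 -> expR y <= 1 + y + 2 * y ^+ 2.
Proof.
move=> hy; have h1 : 0 < 1 - y by lra.
have h2 : 1 - y <= expR (- y) by exact: expR_ge1Dx.
have := expR_gt0 (- y); rewrite expRN => e0.
rewrite -(ler_pM2l e0) mulVf ?gt_eqF ?expR_gt0//.
apply: le_trans (_ : 1 <= (1 - y) * (1 + y + 2 * y ^+ 2)) _.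
  have : 0 <= y ^+ 2 * (1 - 2 * y) by apply: mulr_ge0; [exact: sqr_ge0|lra].
  by rewrite !expr2; lra.
by rewrite -expRN; apply: ler_wpM2r => //; rewrite expr2; nra.
Qed.

(** For [f > 0] this is [1 + e < expR e] at [e = ln (h / f)], multiplied by [f]. The implication
    [0 < f -> 0 < h] keeps out the default value [ln 0 = 0], for which the inequality can fail. *)
Lemma gibbs_gt0 {R : realType} (f h : R) : 0 <= f -> 0 <= h ->
  (0 < f -> 0 < h) -> f != h -> 0 < f * ln f - f * ln h - f + h.
Proof.
move=> f0 h0 fh neq; have [f1|f1] := eqVneq f 0.
  by rewrite f1 in neq *; rewrite !mul0r; lra.
have fp : 0 < f by rewrite lt_def f1.
have hp := fh fp.
have e : ln (h / f) != 0.
  by rewrite ln_eq0 ?divr_gt0// -subr_eq0 -[1](divff f1) -mulrBl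
    mulf_neq0 ?invr_eq0// subr_eq0 eq_sym.
have := expR_gt1Dx e; rewrite lnK ?posrE ?divr_gt0// ltr_pdivlMr// ln_div//.
by lra.
Qed.

Lemma gibbs_ge0 {R : realType} (f h : R) : 0 <= f -> 0 <= h ->
  (0 < f -> 0 < h) -> 0 <= f * ln f - f * ln h - f + h.
Proof.
move=> f0 h0 fh; have [->|neq] := eqVneq f h; first by lra.
exact/ltW/gibbs_gt0.
Qed.

Lemma ln_prod_gt0 {R : realType} {I : Type} (s : seq I) (P : pred I)
    (F : I -> R) : (forall i, P i -> 0 < F i) ->
  ln (\prod_(i <- s | P i) F i) = \sum_(i <- s | P i) ln (F i).
Proof.
move=> F0; elim: s => [|i s ih]; first by rewrite !big_nil ln1.
rewrite !big_cons; case: ifPn => // Pi.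
by rewrite lnM ?ih// posrE ?F0// prodr_gt0.
Qed.

Lemma xlnx_le_xln1Dx {R : realType} (x : R) :
  0 <= x -> x * ln x <= x * ln (1 + x).
Proof.
rewrite le_eqVlt => /predU1P[<-|x0]; first by rewrite !mul0r.
by rewrite ler_wpM2l ?(ltW x0)// ler_ln ?posrE; lra.
Qed.

Lemma xln1Dx_ge0 {R : realType} (x : R) : 0 <= x -> 0 <= x * ln (1 + x).
Proof. by move=> x0; rewrite mulr_ge0// ln_ge0//; lra. Qed.

Lemma le_of_quadratic {R : realType} (a b L t0 : R) : 0 < t0 ->
  (forall t, 0 < t -> t <= t0 -> a * t <= b * t + L * t ^+ 2) -> a <= b.
Proof.
move=> t00 h; rewrite leNgt; apply/negP => ba.
(* For [0 < t <= e] the error [L * t] is below [(a - b) / 2], which contradicts [a <= b + L * t]. *)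
pose e := (a - b) / (2 * (`|L| + 1)).
have L0 := normr_ge0 L.
have e0 : 0 < e by rewrite divr_gt0//; lra.
pose t := Num.min t0 e.
have tp : 0 < t by rewrite lt_min t00.
have := h t tp; rewrite ge_min lexx => /(_ isT) h1.
have te : t <= e by rewrite ge_min lexx orbT.
have h2 : a <= b + L * t.
  by rewrite -(ler_pM2r tp) mulrDl -mulrA -expr2.
have h3 : L * t <= `|L| * e.
  apply: (le_trans (y := `|L| * t)).
    by rewrite ler_wpM2r ?(ltW tp)// ler_norm.
  by rewrite ler_wpM2l.
have h4 : e * (2 * (`|L| + 1)) = a - b by rewrite /e divfK//; apply/eqP; lra.
nra.
Qed.

Lemma powR_gt0_or {R : realType} (a r : R) :
  0 <= r -> (0 < r -> 0 < a) -> 0 < a `^ r.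
Proof.
rewrite le_eqVlt => /predU1P[<- _|r0 h]; first by rewrite powRr0.
by rewrite powR_gt0// h.
Qed.

(** * Integrals that may take the value [-oo], and densities *)

Section integration.
Context {R : realType} {d : measure_display} {T : measurableType d}.
Variable mu : {measure set T -> \bar R}.

Lemma EFin_funepos (u : T -> R) :
  ((EFin \o u)^\+)%E = EFin \o (fun x => Num.max (u x) 0).
Proof. by apply/funext => x; rewrite funeposE /= -EFin_max. Qed.

Lemma EFin_funeneg (u : T -> R) :
  ((EFin \o u)^\-)%E = EFin \o (fun x => Num.max (- u x) 0).
Proof. by apply/funext => x; rewrite funenegE /= -EFin_max. Qed.

(** Marginals are tested against bounded functions only; truncation at height [n] is the way from
    these to unbounded nonnegative ones. *)
Lemma integral_minr_cvg (u w : T -> R) :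
  measurable_fun setT u -> measurable_fun setT w ->
  (forall x, 0 <= u x) -> (forall x, 0 <= w x) ->
  (\int[mu]_x (u x * w x)%:E =
   limn (fun n : nat => \int[mu]_x (Num.min (u x) n%:R * w x)%:E))%E.
Proof.
move=> mu_ mw u0 w0; rewrite -monotone_convergence//.
- apply: eq_integral => x _; apply/esym/lim_near_cst => //.
  have h := archimedean.Num.Theory.truncnS_gt (u x).
  exists (archimedean.Num.Def.truncn (u x)).+1 => // n /= hn.
  rewrite min_l// ltW// (lt_le_trans h)// ler_nat//.
- move=> n; apply/measurable_EFinP/measurable_funM => //.
  exact: measurable_minr.
- by move=> n x _; rewrite lee_fin mulr_ge0// le_min u0 /=.
- move=> x _ n k nk; rewrite lee_fin ler_wpM2r// le_min ge_min lexx /=.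
  by rewrite ge_min ler_nat nk orbT.
Qed.

Lemma integralB_ge0 (a b : T -> R) :
  measurable_fun setT a -> measurable_fun setT b ->
  (forall x, 0 <= a x) -> (forall x, 0 <= b x) ->
  (\int[mu]_x (a x)%:E < +oo)%E ->
  (\int[mu]_x (a x - b x)%:E =
   \int[mu]_x (a x)%:E - \int[mu]_x (b x)%:E)%E.
Proof.
move=> ma mb a0 b0 ia.
have Ia : mu.-integrable setT (EFin \o a).
  apply/integrableP; split; first exact/measurable_EFinP.
  by under eq_integral do rewrite /= ger0_norm//.
have [ib|] := ltP (\int[mu]_x (b x)%:E)%E +oo%E.
  rewrite -integralB_EFin//.
  apply/integrableP; split; first exact/measurable_EFinP.
  by under eq_integral do rewrite /= ger0_norm//.
rewrite leye_eq => /eqP ib; rewrite ib.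
rewrite [LHS]integralE.
(* Both sides are [-oo]: as [b] is at most [a] plus the negative part of [a - b], and [a] has finite
   integral, that negative part has infinite integral. *)
suff -> : (\int[mu]_x ((fun x => (a x - b x)%:E)^\- x) = +oo)%E.
  by rewrite !addeNy.
have fa : (\int[mu]_x (a x)%:E \is a fin_num)%E.
  by rewrite ge0_fin_numE// integral_ge0// => x _; rewrite lee_fin.
have mN : measurable_fun setT (fun x => Num.max (- (a x - b x)) 0).
  apply: measurable_maxr => //; apply: measurableT_comp => //.
  exact: measurable_funB.
have := EFin_funeneg (fun x => a x - b x); rewrite /comp => ->.
apply/eqP; rewrite -leye_eq -(leeD2lE _ _ fa) addey;
  last by case: (\int[mu]_x (a x)%:E)%E fa.
rewrite -ib -ge0_integralD//.
- apply: ge0_le_integral => //.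
  + by move=> x _; rewrite lee_fin.
  + exact/measurable_EFinP.
  + by apply/measurable_EFinP/measurable_funD.
  + move=> x _; rewrite -EFinD lee_fin -lerBlDl le_max.
    by apply/orP; left; lra.
- by move=> x _; rewrite lee_fin.
- exact/measurable_EFinP.
- by move=> x _; rewrite lee_fin le_max lexx orbT.
- exact/measurable_EFinP.
Qed.

(* The negative parts may have infinite integral: both sides are then [-oo]. *)
Lemma integralD_funepos_lty (u v : T -> R) :
  measurable_fun setT u -> measurable_fun setT v ->
  (\int[mu]_x (Num.max (u x) 0)%:E < +oo)%E ->
  (\int[mu]_x (Num.max (v x) 0)%:E < +oo)%E ->
  (\int[mu]_x (u x + v x)%:E =
   \int[mu]_x (u x)%:E + \int[mu]_x (v x)%:E)%E.
Proof.
move=> mu_ mv iu iv.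
have mp (w : T -> R) : measurable_fun setT w ->
    measurable_fun setT (fun x => Num.max (w x) 0).
  by move=> mw; exact: measurable_maxr.
have mn (w : T -> R) : measurable_fun setT w ->
    measurable_fun setT (fun x => Num.max (- w x) 0).
  by move=> mw; apply: mp; exact: measurableT_comp.
have p0 (w : T -> R) x : (0 <= (Num.max (w x) 0)%:E)%E.
  by rewrite lee_fin le_max lexx orbT.
have ie (w : T -> R) : (\int[mu]_x (w x)%:E =
   \int[mu]_x (Num.max (w x) 0)%:E - \int[mu]_x (Num.max (- w x) 0)%:E)%E.
  rewrite integralE; have := EFin_funepos w; have := EFin_funeneg w.
  by rewrite /comp => -> ->.
have fu : (\int[mu]_x (Num.max (u x) 0)%:E \is a fin_num)%E.
  by rewrite ge0_fin_numE// integral_ge0.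
have fv : (\int[mu]_x (Num.max (v x) 0)%:E \is a fin_num)%E.
  by rewrite ge0_fin_numE// integral_ge0.
(* The parts of [u] and [v] are added separately instead of taking those of [u + v]: the minuend
   then has finite integral and [integralB_ge0] applies. *)
transitivity (\int[mu]_x ((Num.max (u x) 0 + Num.max (v x) 0) -
     (Num.max (- u x) 0 + Num.max (- v x) 0))%:E)%E.
  apply: eq_integral => x _; congr (_%:E).
  have H (z : R) : z = Num.max z 0 - Num.max (- z) 0.
    by rewrite /Num.max; case: ltrP => ?; case: ltrP => ?; lra.
  by rewrite {1}(H (u x)) {1}(H (v x)); lra.
have eD (w z : T -> R) : measurable_fun setT w -> measurable_fun setT z ->
   (\int[mu]_x (Num.max (w x) 0 + Num.max (z x) 0)%:E =
    \int[mu]_x (Num.max (w x) 0)%:E + \int[mu]_x (Num.max (z x) 0)%:E)%E.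
  by move=> mw mz; rewrite -ge0_integralD//; apply/measurable_EFinP; exact: mp.
have mN (w : T -> R) : measurable_fun setT w ->
   measurable_fun setT (fun x => - w x).
  by move=> mw; exact: measurableT_comp.
rewrite integralB_ge0.
- rewrite (eD u v)// (eD (fun x => - u x) (fun x => - v x));
    [|exact: mN|exact: mN].
  rewrite (ie u) (ie v) oppeD.
    exact: addeACA.
  by apply: ge0_adde_def; rewrite inE; apply: integral_ge0 => x _;
    [exact: (p0 (fun x => - u x))|exact: (p0 (fun x => - v x))].
- by apply: measurable_funD; exact: mp.
- by apply: measurable_funD; exact: mn.
- by move=> x; rewrite addr_ge0// le_max lexx orbT.
- by move=> x; rewrite addr_ge0// le_max lexx orbT.
- by rewrite eD// lte_add_pinfty.
Qed.

(** The bound on the positive part of the sum goes along with the induction because adding the next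
    term requires it. *)
Lemma integral_sum_funepos_lty {I : Type} (s : seq I) (u : I -> T -> R) :
  (forall i, measurable_fun setT (u i)) ->
  (forall i, \int[mu]_x (Num.max (u i x) 0)%:E < +oo)%E ->
  (\int[mu]_x (Num.max (\sum_(i <- s) u i x) 0)%:E < +oo)%E /\
  (\int[mu]_x (\sum_(i <- s) u i x)%:E =
   \sum_(i <- s) \int[mu]_x (u i x)%:E)%E.
Proof.
move=> mu_ iu; elim: s => [|i s [ih1 ih2]].
  split; last first.
    by under eq_integral do rewrite big_nil; rewrite integral0 big_nil.
  by under eq_integral do rewrite big_nil maxxx; rewrite integral0 ltry.
have mmax (w : T -> R) : measurable_fun setT w ->
    measurable_fun setT (fun x => (Num.max (w x) 0)%:E).
  by move=> mw; apply/measurable_EFinP; exact: measurable_maxr.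
have ms : measurable_fun setT (fun x => \sum_(i <- s) u i x).
  exact: measurable_sum.
have max0 (y : R) : (0 <= (Num.max y 0)%:E)%E.
  by rewrite lee_fin le_max lexx orbT.
split.
  apply: (@le_lt_trans _ _ (\int[mu]_x ((Num.max (u i x) 0)%:E +
      (Num.max (\sum_(i <- s) u i x) 0)%:E))%E).
    apply: ge0_le_integral => //.
    - by apply: mmax; under eq_fun do rewrite big_cons; exact: measurable_funD.
    - by apply: emeasurable_funD; exact: mmax.
    - move=> x _; rewrite -EFinD lee_fin big_cons ge_max.
      by rewrite addr_ge0 ?lerD// le_max lexx ?orbT.
  rewrite ge0_integralD//; [|exact: mmax|exact: mmax].
  exact: lte_add_pinfty.
under eq_integral do rewrite big_cons.
by rewrite integralD_funepos_lty// ih2 big_cons.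
Qed.

(** The integral is a difference of two nonnegative terms; since [+oo - +oo] is [-oo], a finite
    value forces both terms to be finite. *)
Lemma integrable_fin_num_integral (u : T -> R) : measurable_fun setT u ->
  (\int[mu]_x (u x)%:E)%E \is a fin_num -> mu.-integrable setT (EFin \o u).
Proof.
move=> mu_ fu.
have mE : measurable_fun setT (EFin \o u) by exact/measurable_EFinP.
apply/integrableP; split => //.
rewrite -/(abse \o (EFin \o u)) fune_abse ge0_integralD//;
  [|exact: measurable_funepos|exact: measurable_funeneg].
move: fu; rewrite integralE -/(EFin \o u).
have : (0 <= \int[mu]_x (EFin \o u)^\+ x)%E by exact: integral_ge0.
have : (0 <= \int[mu]_x (EFin \o u)^\- x)%E by exact: integral_ge0.
move: (\int[mu]_x (EFin \o u)^\+ x)%E (\int[mu]_x (EFin \o u)^\- x)%E.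
by move=> [a||] [b||] //= _ _ _; rewrite -EFinD ltry.
Qed.

Lemma density_measurable (f : T -> R) : is_density mu f ->
  measurable_fun setT f.
Proof. by case=> _ /integrableP[/measurable_EFinP]. Qed.

Lemma density_ge0 (f : T -> R) x : is_density mu f -> 0 <= f x.
Proof. by case. Qed.

Lemma density_integrable (f : T -> R) : is_density mu f ->
  mu.-integrable setT (EFin \o f).
Proof. by case. Qed.

Lemma density_integral (f : T -> R) : is_density mu f ->
  (\int[mu]_x (f x)%:E = 1)%E.
Proof. by case. Qed.

Lemma measurable_mul_ln (f : T -> R) : measurable_fun setT f ->
  measurable_fun setT (fun x => f x * ln (f x)).
Proof.
move=> mf; apply: measurable_funM => //.
by apply: (measurableT_comp (@measurable_ln R)).
Qed.

Lemma measurable_mul_ln1D (f : T -> R) : measurable_fun setT f ->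
  measurable_fun setT (fun x => f x * ln (1 + f x)).
Proof.
move=> mf; apply: measurable_funM => //.
apply: (measurableT_comp (@measurable_ln R)); exact: measurable_funD.
Qed.

Lemma finite_entropy_funepos_lty (f : T -> R) : measurable_fun setT f ->
  (forall x, 0 <= f x) -> finite_entropy mu f ->
  (\int[mu]_x (Num.max (f x * ln (f x)) 0)%:E < +oo)%E.
Proof.
move=> mf f0; apply: le_lt_trans; apply: ge0_le_integral => //.
- by move=> x _; rewrite lee_fin le_max lexx orbT.
- by apply/measurable_EFinP/measurable_maxr => //; exact: measurable_mul_ln.
- by apply/measurable_EFinP; exact: measurable_mul_ln1D.
- by move=> x _; rewrite lee_fin ge_max xlnx_le_xln1Dx// xln1Dx_ge0.
Qed.

Lemma entropy_fin_num (f : T -> R) : measurable_fun setT f ->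
  (forall x, 0 <= f x) -> finite_entropy mu f -> entropy mu f <> -oo%E ->
  entropy mu f \is a fin_num.
Proof.
move=> mf f0 fe; rewrite /entropy integralE.
have := finite_entropy_funepos_lty mf f0 fe.
have := EFin_funepos (fun x => f x * ln (f x)); rewrite /comp => -> /= lt h.
have : (0 <= \int[mu]_x (Num.max (f x * ln (f x)) 0)%:E)%E.
  by apply: integral_ge0 => x _; rewrite lee_fin le_max lexx orbT.
have : (0 <= \int[mu]_x (fun x0 => (f x0 * ln (f x0))%:E)^\- x)%E.
  exact: integral_ge0.
move: lt h.
move: (\int[mu]_x (Num.max (f x * ln (f x)) 0)%:E)%E.
move: (\int[mu]_x (fun x0 => (f x0 * ln (f x0))%:E)^\- x)%E.
by move=> [a||] [b||].
Qed.

End integration.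

(** * Marginals: change of variables, positivity and uniqueness *)

Section marginal.
Context {R : realType} {d d' : measure_display}.
Context {T : measurableType d} {M : measurableType d'}.
Variables (mu : {measure set T -> \bar R}) (nu : {measure set M -> \bar R}).
Variables (p : T -> M) (f : T -> R) (g : M -> R).
Hypothesis mp : measurable_fun setT p.
Hypothesis df : is_density mu f.
Hypothesis fg : is_marginal mu nu p f g.

Let mf : measurable_fun setT f := density_measurable df.
Let dg : is_density nu g := fg.1.
Let mg : measurable_fun setT g := density_measurable dg.
Let f0 : forall x, 0 <= f x. Proof. by case: df. Qed.
Let g0 : forall x, 0 <= g x. Proof. by case: dg. Qed.

Lemma marginal_ge0_integral (psi : M -> R) : measurable_fun setT psi ->
  (forall t, 0 <= psi t) ->
  (\int[mu]_x (psi (p x) * f x)%:E = \int[nu]_t (psi t * g t)%:E)%E.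
Proof.
move=> mpsi psi0; rewrite !integral_minr_cvg//;
  last exact: (measurableT_comp mpsi).
congr (limn _); apply/funext => n.
apply: (fg.2 (fun t => Num.min (psi t) n%:R)).
  exact: measurable_minr.
apply/bounded_fun_le; exists n%:R => t.
by rewrite ger0_norm ?le_min ?psi0//= ge_min lexx orbT.
Qed.

(** Valid for infinite values too: as [f] and [g] are nonnegative, the positive and negative parts
    fall on [psi] alone, and each is transported by the nonnegative case. *)
Lemma marginal_integral (psi : M -> R) : measurable_fun setT psi ->
  (\int[mu]_x (psi (p x) * f x)%:E = \int[nu]_t (psi t * g t)%:E)%E.
Proof.
move=> mpsi; rewrite [LHS]integralE [RHS]integralE.
have := EFin_funepos (fun t => psi t * g t); rewrite /comp => ->.
have := EFin_funeneg (fun t => psi t * g t); rewrite /comp => ->.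
have := EFin_funepos (fun x => psi (p x) * f x); rewrite /comp => ->.
have := EFin_funeneg (fun x => psi (p x) * f x); rewrite /comp => ->.
have maxM (a b : R) : 0 <= b -> Num.max (a * b) 0 = Num.max a 0 * b.
  by move=> b0; rewrite maxr_pMl// mul0r.
under eq_integral do rewrite maxM//.
under [X in (_ - X)%E]eq_integral do rewrite -mulNr maxM//.
under [X in (_ = X - _)%E]eq_integral do rewrite maxM//.
under [X in (_ = _ - X)%E]eq_integral do rewrite -mulNr maxM//.
rewrite (marginal_ge0_integral (psi := fun t => Num.max (psi t) 0));
  last 2 first.
- exact: measurable_maxr.
- by move=> t; rewrite le_max lexx orbT.
rewrite (marginal_ge0_integral (psi := fun t => Num.max (- psi t) 0))//.
- by apply: measurable_maxr => //; exact: measurableT_comp.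
- by move=> t; rewrite le_max lexx orbT.
Qed.

Lemma marginal_integrable (psi : M -> R) : measurable_fun setT psi ->
  nu.-integrable setT (fun t => (psi t * g t)%:E) ->
  mu.-integrable setT (fun x => (psi (p x) * f x)%:E).
Proof.
move=> mpsi /integrableP[_ i]; apply/integrableP; split.
  by apply/measurable_EFinP/measurable_funM => //; exact: measurableT_comp.
move: i; under eq_integral do rewrite /= normrM [X in _ * X]ger0_norm//.
under [in X in _ -> X]eq_integral do rewrite /= normrM [X in _ * X]ger0_norm//.
rewrite (marginal_ge0_integral (psi := fun t => `|psi t|))//.
exact: measurableT_comp.
Qed.

(** Test with the indicator of the zero set of [g]: [f] has no mass on its preimage. This makes the
    logarithms of the marginals genuine almost everywhere on the support of [f]. *)
Lemma marginal_gt0_ae : {ae mu, forall x, 0 < f x -> 0 < g (p x)}.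
Proof.
pose Z := g @^-1` [set 0].
have mZ : measurable Z by rewrite -[Z]setTI; exact: mg.
have := @marginal_ge0_integral (\1_Z) (measurable_indic mZ).
have -> : (\int[nu]_t (\1_Z t * g t)%:E = 0)%E.
  apply: integral0_eq => t _; rewrite indicE.
  case: (boolP (t \in Z)) => [|_]; last by rewrite mul0r.
  by rewrite inE /Z /= => ->; rewrite mulr0.
move=> /(_ ltac:(by move=> t; rewrite indicE ler0n)) h.
have mI : measurable_fun setT (fun x => (\1_Z (p x) * f x)%:E).
  apply/measurable_EFinP/measurable_funM => //.
  exact: (measurableT_comp (measurable_indic mZ)).
have := (ae_eq_integral_abs mu measurableT mI).1.
under eq_integral do rewrite /= ger0_norm ?mulr_ge0 ?indicE ?ler0n//.
under eq_integral do rewrite -indicE.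
move=> /(_ h); apply: filterS => x /= /(_ I) [].
rewrite indicE => hx fx; rewrite lt_def g0 andbT; apply/eqP => gz.
move: hx; rewrite mem_set// mul1r => fx0; by rewrite fx0 ltxx in fx.
Qed.

Lemma marginal_unique (g' : M -> R) : is_marginal mu nu p f g' ->
  {ae nu, forall t, g t = g' t}.
Proof.
move=> fg'.
have [h1 h2] := fg'.
have : ae_eq nu setT (EFin \o g) (EFin \o g').
  apply: integral_ae_eq => //.
  - exact: density_integrable.
  - exact/measurable_EFinP/(density_measurable h1).
  - move=> E _ mE.
    have ind (w : M -> R) :
        (\int[nu]_(x in E) (EFin \o w) x = \int[nu]_x (\1_E x * w x)%:E)%E.
      rewrite integral_mkcond; apply: eq_integral => t _.
      by rewrite patchE indicE; case: ifP => _; rewrite ?mul1r ?mul0r.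
    rewrite !ind -fg.2 ?h2//.
    + apply/bounded_fun_le; exists 1 => t.
      by rewrite indicE ger0_norm ?ler0n// lern1 leq_b1.
    + apply/bounded_fun_le; exists 1 => t.
      by rewrite indicE ger0_norm ?ler0n// lern1 leq_b1.
by apply: filterS => t /(_ I) [].
Qed.

(** Moves the entropy to the common space of all the marginals, where the terms of (S) can be
    compared pointwise. *)
Lemma marginal_entropy : 
  (entropy nu g = \int[mu]_x (ln (g (p x)) * f x)%:E)%E.
Proof.
rewrite (marginal_integral (psi := fun t => ln (g t))); last first.
  exact: (measurableT_comp (@measurable_ln R)).
by apply: eq_integral => t _; rewrite mulrC.
Qed.

End marginal.

Lemma entropy_ae_eq {R : realType} {d} {M : measurableType d}
    (nu : {measure set M -> \bar R}) (g g' : M -> R) :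
  measurable_fun setT g -> measurable_fun setT g' ->
  {ae nu, forall t, g t = g' t} -> entropy nu g = entropy nu g'.
Proof.
move=> mg mg' h; apply: ae_eq_integral => //.
- exact/measurable_EFinP/measurable_mul_ln.
- exact/measurable_EFinP/measurable_mul_ln.
- by apply: filterS h => t /= -> _.
Qed.

(** * Calculus of integrals with real values *)

(** Integrability and value are bundled so that linear combinations can be computed in [R], free of
    side conditions on infinite values. *)
Definition has_integral {R : realType} {d} {T : measurableType d}
    (mu : {measure set T -> \bar R}) (u : T -> R) (r : R) : Prop :=
  mu.-integrable setT (EFin \o u) /\ (\int[mu]_x (u x)%:E = r%:E)%E.

Section has_integral.
Context {R : realType} {d : measure_display} {T : measurableType d}.
Variable mu : {measure set T -> \bar R}.

Lemma has_integralD (u v : T -> R) (a b : R) :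
  has_integral mu u a -> has_integral mu v b ->
  has_integral mu (fun x => u x + v x) (a + b).
Proof.
move=> [iu ua] [iv vb]; split; first exact: (integrableD measurableT iu iv).
by rewrite EFinD -ua -vb -integralD_EFin.
Qed.

Lemma has_integralZ (k : R) (u : T -> R) (a : R) :
  has_integral mu u a -> has_integral mu (fun x => k * u x) (k * a).
Proof.
move=> [iu ua]; split; first exact: (integrableZl measurableT k iu).
by rewrite EFinM -ua -integralZl.
Qed.

Lemma has_integral_sum {I : Type} (s : seq I) (u : I -> T -> R) (a : I -> R) :
  (forall i, has_integral mu (u i) (a i)) ->
  has_integral mu (fun x => \sum_(i <- s) u i x) (\sum_(i <- s) a i).
Proof.
move=> ua; elim: s => [|i s ih].
  rewrite big_nil; under eq_fun do rewrite big_nil.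
  by split; [exact: integrable0|exact: integral0].
by rewrite big_cons; under eq_fun do rewrite big_cons; exact: has_integralD.
Qed.

Lemma has_integral_density (f : T -> R) : is_density mu f ->
  has_integral mu f 1.
Proof. by case=> _ ? ?; split. Qed.

Lemma has_integral_ge0_le (u : T -> R) (a : R) : measurable_fun setT u ->
  (forall x, 0 <= u x) -> (\int[mu]_x (u x)%:E <= a%:E)%E ->
  exists2 r, has_integral mu u r & r <= a.
Proof.
move=> mu_ u0 le.
have fu : (\int[mu]_x (u x)%:E \is a fin_num)%E.
  rewrite ge0_fin_numE ?(le_lt_trans le) ?ltry//.
  by apply: integral_ge0 => x _; rewrite lee_fin.
exists (fine (\int[mu]_x (u x)%:E)%E).
  by split; [exact: integrable_fin_num_integral|rewrite fineK].
by rewrite -lee_fin fineK.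
Qed.

Lemma has_integral_bounded (phi u : T -> R) (K : R) : measurable_fun setT phi ->
  (forall x, `|phi x| <= K) -> mu.-integrable setT (EFin \o u) ->
  exists r, has_integral mu (fun x => phi x * u x) r.
Proof.
move=> mphi hK iu.
have i : mu.-integrable setT (EFin \o (fun x => phi x * u x)).
  have := @integrableMr _ _ _ mu setT measurableT phi (EFin \o u) mphi.
  by apply => //; apply/bounded_fun_le; exists K.
exists (fine (\int[mu]_x (phi x * u x)%:E)%E); split => //.
by rewrite fineK//; exact: (integrable_fin_num measurableT i).
Qed.

Lemma le_has_integral (u v : T -> R) (a b : R) : has_integral mu u a ->
  has_integral mu v b -> (forall x, u x <= v x) -> a <= b.
Proof.
move=> [iu ua] [iv vb] uv; rewrite -lee_fin -ua -vb.
by apply: le_integral => // x _; rewrite lee_fin.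
Qed.

Lemma integralZl_funepos_lty (k : R) (u : T -> R) : 0 <= k ->
  measurable_fun setT u ->
  (\int[mu]_x (Num.max (u x) 0)%:E < +oo)%E ->
  (\int[mu]_x (k * u x)%:E = k%:E * \int[mu]_x (u x)%:E)%E.
Proof.
move=> k0 mu_ iu.
have fu : (\int[mu]_x (Num.max (u x) 0)%:E \is a fin_num)%E.
  rewrite ge0_fin_numE// integral_ge0// => x _.
  by rewrite lee_fin le_max lexx orbT.
have mN : measurable_fun setT (fun x => - u x) by exact: measurableT_comp.
rewrite [LHS]integralE [X in (_ = _ * X)%E]integralE.
have := EFin_funepos u; rewrite /comp => ->.
have := EFin_funeneg u; rewrite /comp => ->.
have := EFin_funepos (fun x => k * u x); rewrite /comp => ->.
have := EFin_funeneg (fun x => k * u x); rewrite /comp => ->.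
rewrite muleBr//; last by rewrite fin_num_adde_defr.
have maxM (y : R) : Num.max (k * y) 0 = k * Num.max y 0.
  by rewrite maxr_pMr// mulr0.
have eZ (w : T -> R) : measurable_fun setT w ->
    (\int[mu]_x (k * Num.max (w x) 0)%:E =
     k%:E * \int[mu]_x (Num.max (w x) 0)%:E)%E.
  move=> mw; under eq_integral do rewrite EFinM.
  rewrite ge0_integralZl//.
  - by apply/measurable_EFinP; exact: measurable_maxr.
  - by move=> x _; rewrite lee_fin le_max lexx orbT.
under eq_integral do rewrite maxM.
under [X in (_ - X)%E]eq_integral do rewrite -mulrN maxM.
by rewrite eZ// (eZ (fun x => - u x)).
Qed.

End has_integral.

(** * The Brascamp-Lieb product and its logarithm *)

Section brascamp_lieb.
Context {R : realType} {d : measure_display} {Omega : measurableType d}.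
Variable mu : {measure set Omega -> \bar R}.
Context {m : nat} {dM : 'I_m -> measure_display}.
Context {M : forall j : 'I_m, measurableType (dM j)}.
Variables (nu : forall j : 'I_m, {measure set (M j) -> \bar R}).
Variables (p : forall j : 'I_m, Omega -> M j).
Hypothesis p_meas : forall j : 'I_m, measurable_fun setT (p j).
Variables (c : 'I_m -> R) (D : R).
Hypothesis c_ge0 : forall j : 'I_m, 0 <= c j.

Lemma bl_prod_ge0 (f : forall j, M j -> R) x : 0 <= bl_prod p c f x.
Proof. by apply: prodr_ge0 => j _; exact: powR_ge0. Qed.

Lemma measurable_bl_prod (f : forall j, M j -> R) :
  (forall j, measurable_fun setT (f j)) ->
  measurable_fun setT (bl_prod p c f).
Proof.
move=> mf; apply: measurable_prod => j _.
apply: (measurableT_comp (measurable_powR (c j))).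
exact: measurableT_comp.
Qed.

Lemma bl_prod_gt0 (f : forall j, M j -> R) x :
  (forall j, 0 < c j -> 0 < f j (p j x)) -> 0 < bl_prod p c f x.
Proof.
by move=> h; apply: prodr_gt0 => j _; apply: powR_gt0_or => //; exact: h.
Qed.

Lemma ln_bl_prod (f : forall j, M j -> R) x :
  (forall j, 0 < c j -> 0 < f j (p j x)) ->
  ln (bl_prod p c f x) = \sum_(j < m) c j * ln (f j (p j x)).
Proof.
move=> h; rewrite ln_prod_gt0; last first.
  by move=> j _; apply: powR_gt0_or => //; exact: h.
by apply: eq_bigr => j _; rewrite ln_powR.
Qed.

Lemma bl_rhs_density (f : forall j, M j -> R) :
  (forall j, is_density (nu j) (f j)) -> bl_rhs nu c D f = (expR D)%:E.
Proof.
move=> df; rewrite /bl_rhs big1 ?mule1// => j _.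
by rewrite density_integral// poweR1r.
Qed.

Lemma integral_scaled_bl_prod (f : forall j, M j -> R) :
  (forall j, measurable_fun setT (f j)) ->
  (\int[mu]_x (expR (- D) * bl_prod p c f x)%:E =
   (expR (- D))%:E * bl_lhs mu p c f)%E.
Proof.
move=> mf; under eq_integral do rewrite EFinM.
rewrite ge0_integralZl//.
- exact/measurable_EFinP/measurable_bl_prod.
- by move=> x _; rewrite lee_fin bl_prod_ge0.
Qed.

Hypothesis BL : brascamp_lieb mu nu p c D.

(** Finiteness is asked of the product because for [k = 0] the entropy itself may be infinite, with
    [0 * -oo = 0]. *)
Lemma marginal_weighted_has_integral (k : R) (f : Omega -> R) j (g : M j -> R) :
  0 <= k -> is_density mu f -> is_marginal mu (nu j) (p j) f g ->
  (k%:E * entropy (nu j) g)%E \is a fin_num ->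
  has_integral mu (fun x => k * (ln (g (p j x)) * f x))
    (fine (k%:E * entropy (nu j) g)%E).
Proof.
move=> k0 df fg fin; have dg := fg.1; have mg := density_measurable dg.
move: k0 fin; rewrite le_eqVlt => /predU1P[<- _|k0 fin].
  rewrite mul0e /=; under eq_fun do rewrite mul0r.
  by split; [exact: integrable0|exact: integral0].
have fe : entropy (nu j) g \is a fin_num.
  move: fin; case: (entropy (nu j) g) => //=.
  - by rewrite gt0_muley// lte_fin.
  - by rewrite gt0_muleNy// lte_fin.
have mln : measurable_fun setT (fun t => ln (g t)).
  exact: (measurableT_comp (@measurable_ln R)).
rewrite fineM//=; apply: has_integralZ; split; last first.
  by rewrite fineK// -(marginal_entropy (@p_meas j) df fg).
apply: (marginal_integrable (@p_meas j) df fg mln).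
under eq_fun do rewrite mulrC.
exact: (integrable_fin_num_integral (measurable_mul_ln mg) fe).
Qed.

(** * Equality in (S): the Gibbs defect has integral zero *)

Lemma entropy_equality_case (f : Omega -> R) (g : forall j, M j -> R) :
  is_density mu f -> finite_entropy mu f -> entropy mu f <> -oo%E ->
  (forall j, is_marginal mu (nu j) (p j) f (g j)) ->
  weighted_entropy nu c g = (entropy mu f + D%:E)%E ->
  bl_lhs mu p c g = bl_rhs nu c D g /\
  {ae mu, forall x, f x = expR (- D) * bl_prod p c g x}.
Proof.
move=> df fe fNy fg eqS.
have mf := density_measurable df.
have f0 x : 0 <= f x := density_ge0 x df.
have dg j : is_density (nu j) (g j) := (fg j).1.
have mg j := density_measurable (dg j).
have fS := entropy_fin_num mf f0 fe fNy.
set S := fine (entropy mu f).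
have S_E : entropy mu f = S%:E by rewrite fineK.
have hS : has_integral mu (fun x => f x * ln (f x)) S.
  by split; [exact: (integrable_fin_num_integral (measurable_mul_ln mf))|].
(* A sum of extended reals is finite only if each term is. *)
have fW : forall j, ((c j)%:E * entropy (nu j) (g j))%E \is a fin_num.
  have : weighted_entropy nu c g \is a fin_num by rewrite eqS S_E.
  by move=> /sum_fin_numP h j; apply: h => //; rewrite mem_index_enum.
set w := fun j => fine ((c j)%:E * entropy (nu j) (g j))%E.
have hW : \sum_j w j = S + D.
  apply: EFin_inj; rewrite -sumEFin /w EFinD -S_E -eqS /weighted_entropy.
  by apply: eq_bigr => j _; rewrite fineK.
pose u j x := c j * (ln (g j (p j x)) * f x).
have hu : has_integral mu (fun x => \sum_j u j x) (S + D).
  rewrite -hW; apply: has_integral_sum => j.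
  exact: marginal_weighted_has_integral.
pose h x := expR (- D) * bl_prod p c g x.
have h0 x : 0 <= h x by rewrite mulr_ge0 ?expR_ge0 ?bl_prod_ge0.
have mh : measurable_fun setT h.
  by apply: measurable_funM => //; exact: measurable_bl_prod.
have BLg : (\int[mu]_x (h x)%:E <= 1%:E)%E.
  rewrite integral_scaled_bl_prod//.
  apply: (le_trans (y := ((expR (- D))%:E * (expR D)%:E)%E)).
    rewrite lee_wpmul2l ?lee_fin ?expR_ge0// -(bl_rhs_density dg).
    by apply: BL => // j t; exact: density_ge0.
  by rewrite -EFinM -expRD addNr expR0.
have [H hH H1] := has_integral_ge0_le mh h0 BLg.
(* Wherever the logarithms are genuine this is the Gibbs expression [f ln f - f ln h - f + h], with
   [ln h] expanded. In this form each of the four pieces has a known integral, and [S] and [D]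
   cancel. *)
pose F x := (f x * ln (f x) + (-1) * \sum_j u j x) + ((D - 1) * f x + h x).
have hF : has_integral mu F (H - 1).
  have -> : H - 1 = (S + (-1) * (S + D)) + ((D - 1) * 1 + H) by ring.
  apply: has_integralD; apply: has_integralD => //.
    exact: has_integralZ.
  by apply: has_integralZ; exact: has_integral_density.
have aepos : {ae mu, forall x, forall j, 0 < f x -> 0 < g j (p j x)}.
  by apply: filter_forall => j; exact: (marginal_gt0_ae (@p_meas j) df (fg j)).
have aeF : {ae mu, forall x, (0 < f x -> 0 < h x) /\
    F x = f x * ln (f x) - f x * ln (h x) - f x + h x}.
  apply: filterS aepos => x gpos.
  have [fx0|fx0] := eqVneq (f x) 0.
    by rewrite /F /u fx0 ltxx big1 => [|j _];
      [split => //; ring|rewrite !mulr0].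
  have fx : 0 < f x by rewrite lt_def fx0 f0.
  have gx j : 0 < c j -> 0 < g j (p j x) by move=> _; exact: gpos.
  have bx := bl_prod_gt0 gx.
  split; first by rewrite mulr_gt0 ?expR_gt0.
  rewrite /F {2}/h lnM ?posrE ?expR_gt0// expRK ln_bl_prod//.
  have -> : \sum_j u j x = f x * \sum_(j < m) c j * ln (g j (p j x)).
    by rewrite mulr_sumr; apply: eq_bigr => j _; rewrite /u; ring.
  by ring.
have mF : measurable_fun setT (EFin \o F) by have [/integrableP[]] := hF.
have absF : (\int[mu]_x `|(EFin \o F) x| = (H - 1)%:E)%E.
  rewrite -hF.2; apply: ae_eq_integral => //; first exact: measurableT_comp.
  apply: filterS aeF => x [fh Fx] _ /=.
  by rewrite ger0_norm// Fx gibbs_ge0.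
(* (BL) gives [H <= 1], while [H - 1] is the integral of [|F|]. *)
have H_eq1 : H - 1 = 0.
  apply/eqP; rewrite eq_le subr_le0 H1 /= -lee_fin -absF.
  exact: integral_ge0.
split.
  have := hH.2; rewrite integral_scaled_bl_prod// bl_rhs_density// => h1.
  have := congr1 (fun y => (expR D)%:E * y)%E h1.
  rewrite muleA -EFinM -expRD subrr expR0 mul1e => ->.
  by rewrite -EFinM (_ : H = 1) ?mulr1//; apply/eqP; rewrite -subr_eq0 H_eq1.
have := (ae_eq_integral_abs mu measurableT mF).1.
rewrite absF H_eq1 => /(_ erefl).
apply: filterS2 aeF => x [fh Fx] /(_ I) [Fx0].
apply/eqP/negPn/negP => neq.
by have := gibbs_gt0 (f0 x) (h0 x) fh neq; rewrite -Fx Fx0 ltxx.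
Qed.

(** * Equality in (BL): marginals by exponential tilting *)

(** The perturbation is exponential because it then keeps [f j] nonnegative and passes through the
    power [c j] as an exact factor. *)
Lemma bl_prod_tilt (f : forall j, M j -> R) j (a : M j -> R) x :
  (forall i t, 0 <= f i t) ->
  bl_prod p c (dfwith f j (fun t => expR (a t) * f j t)) x =
  expR (c j * a (p j x)) * bl_prod p c f x.
Proof.
move=> f0; rewrite /bl_prod (bigD1 j)//= dfwithin [in RHS](bigD1 j)//= mulrA.
congr (_ * _).
  by rewrite powRM ?expR_ge0// -expRM [a _ * _]mulrC.
by apply: eq_bigr => i ij; rewrite dfwithout// eq_sym.
Qed.

Lemma bl_rhs_tilt (f : forall j, M j -> R) j (g : M j -> R) :
  (forall i, is_density (nu i) (f i)) ->
  bl_rhs nu c D (dfwith f j g) =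
  ((expR D)%:E * (\int[nu j]_t (g t)%:E) `^ (c j))%E.
Proof.
move=> df; rewrite /bl_rhs (bigD1 j)//= dfwithin big1 ?mule1// => i ij.
by rewrite dfwithout 1?eq_sym// density_integral// poweR1r.
Qed.

Variable fj : forall j : 'I_m, M j -> R.
Arguments fj : clear implicits.
Hypothesis dfj : forall j, is_density (nu j) (fj j).
Hypothesis BLeq : bl_lhs mu p c fj = bl_rhs nu c D fj.

Let f x := expR (- D) * bl_prod p c fj x.
Let mfj j : measurable_fun setT (fj j) := density_measurable (dfj j).
Let fj0 j t : 0 <= fj j t := density_ge0 t (dfj j).

Lemma is_density_extremal : is_density mu f.
Proof.
have f0 x : 0 <= f x by rewrite mulr_ge0 ?expR_ge0 ?bl_prod_ge0.
have f1 : (\int[mu]_x (f x)%:E = 1)%E.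
  rewrite integral_scaled_bl_prod// BLeq bl_rhs_density//.
  by rewrite -EFinM -expRD addNr expR0.
split => //; apply: integrable_fin_num_integral; last by rewrite f1.
by apply: measurable_funM => //; exact: measurable_bl_prod.
Qed.

(** With [y = t B + 2 t^2 K^2], the tilt bounds the integral of [expR y] type factors on both sides:
    [1 + c_j t A] is at most the tilted left side of (BL), which is at most [expR (c_j y)].
    Expanding the latter to second order leaves [A <= B]. *)
Lemma extremal_marginal_le j (phi : M j -> R) (K A B : R) :
  0 < c j -> measurable_fun setT phi -> (forall t, `|phi t| <= K) ->
  has_integral mu (fun x => phi (p j x) * f x) A ->
  has_integral (nu j) (fun t => phi t * fj j t) B -> A <= B.
Proof.
move=> cj0 mphi hK hA hB.
have df := is_density_extremal.
have K1 : exists2 K', 0 < K' & forall t, `|phi t| <= K'.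
  exists (`|K| + 1); first by have := normr_ge0 K; lra.
  by move=> t; rewrite (le_trans (hK t))// (le_trans (ler_norm K))// lerDl.
have {K hK K1} [K K0 hK] := K1.
pose E := `|B| + 2 * K ^+ 2.
have E0 : 0 < E by rewrite ltr_wpDl// mulr_gt0// exprn_gt0.
(* [t <= 1] gives [|y| <= t * E]; the other two bounds put [t * phi] and [c j * y] below 1/2, the
   range of [expR_le_quadratic]. *)
pose t0 := Num.min 1 (Num.min (2 * K)^-1 (2 * c j * E)^-1).
have t00 : 0 < t0 by rewrite !lt_min ltr01 !invr_gt0 !mulr_gt0.
rewrite -(ler_pM2l cj0).
(* The first summand of the constant comes from the quadratic term of [y], the second from the term
   [2 (c_j y)^2] in the expansion of [expR (c_j y)]. *)
apply: (@le_of_quadratic _ _ _ 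
  (2 * c j * K ^+ 2 + 2 * (c j * E) ^+ 2) t0) => //.
move=> t tp; rewrite !le_min => /and3P[t1 tK tE].
have tphi s : `|t * phi s| <= 2^-1.
  rewrite normrM gtr0_norm//; apply: (le_trans (y := t * K)).
    by rewrite ler_wpM2l// ltW.
  have K2 : 0 < 2 * K by exact: mulr_gt0.
  by rewrite -(ler_pM2r K2) mulVf ?gt_eqF// in tK; lra.
pose y := t * B + t ^+ 2 * (2 * K ^+ 2).
pose G := fun s => expR (t * phi s) * fj j s.
have mG : measurable_fun setT G.
  apply: measurable_funM => //; apply: (measurableT_comp (@measurable_expR R)).
  exact: measurable_funM.
have intG : (\int[nu j]_s (G s)%:E <= (expR y)%:E)%E.
  have hQ : has_integral (nu j)
      (fun s => fj j s + (t * (phi s * fj j s) +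
        (2 * t ^+ 2 * K ^+ 2) * fj j s))
      (1 + (t * B + (2 * t ^+ 2 * K ^+ 2) * 1)).
    apply: has_integralD; first exact: has_integral_density.
    apply: has_integralD; first exact: has_integralZ.
    by apply: has_integralZ; exact: has_integral_density.
  apply: (le_trans (y := (1 + y)%:E)); last by rewrite lee_fin expR_ge1Dx.
  have -> : 1 + y = 1 + (t * B + (2 * t ^+ 2 * K ^+ 2) * 1) by rewrite /y; ring.
  rewrite -hQ.2; apply: ge0_le_integral => //.
  - by move=> s _; rewrite lee_fin mulr_ge0 ?expR_ge0.
  - exact/measurable_EFinP.
  - by have [/integrableP[]] := hQ.
  - move=> s _; rewrite lee_fin.
    have h1 : expR (t * phi s) <= 1 + t * phi s + 2 * t ^+ 2 * K ^+ 2.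
      apply: (le_trans (expR_le_quadratic _)).
        exact: le_trans (ler_norm _) (tphi s).
      rewrite lerD2l -mulrA ler_pM2l// exprMn ler_wpM2l ?sqr_ge0//.
      by rewrite -[phi s ^+ 2]real_normK ?num_real// lerXn2r ?nnegrE// ltW.
    have /le_trans := ler_wpM2r (fj0 s) h1; apply.
    by lra.
have intL : (\int[mu]_x (expR (c j * (t * phi (p j x))) * f x)%:E <=
    (expR (c j * y))%:E)%E.
  have -> : (\int[mu]_x (expR (c j * (t * phi (p j x))) * f x)%:E =
      (expR (- D))%:E * bl_lhs mu p c (dfwith fj j G))%E.
    rewrite -integral_scaled_bl_prod//; last by move=> i; case: dfwithP.
    apply: eq_integral => x _; congr (_%:E).
    by rewrite /G bl_prod_tilt// /f; ring.
  apply: (le_trans (y := ((expR (- D))%:E * bl_rhs nu c D (dfwith fj j G))%E)).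
    rewrite lee_wpmul2l ?lee_fin ?expR_ge0//; apply: BL.
      by move=> i; case: dfwithP.
    move=> i; case: dfwithP => // s; by rewrite mulr_ge0 ?expR_ge0.
  rewrite bl_rhs_tilt// muleA -EFinM -expRD addNr expR0 mul1e.
  rewrite mulrC expRM -poweR_EFin; apply: gt0_ler_poweR => //.
    rewrite in_itv/= leey andbT; apply: integral_ge0 => s _.
    by rewrite lee_fin mulr_ge0 ?expR_ge0.
  by rewrite in_itv/= leey andbT lee_fin expR_ge0.
have mL : measurable_fun setT (fun x => expR (c j * (t * phi (p j x))) * f x).
  apply: measurable_funM; last exact: density_measurable df.
  apply: (measurableT_comp (@measurable_expR R)).
  do 2 apply: measurable_funM => //; exact: measurableT_comp.
have [r hr rle] := has_integral_ge0_le mL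
  (fun x => mulr_ge0 (expR_ge0 _) (density_ge0 x df)) intL.
have hl : has_integral mu (fun x => f x + (c j * t) * (phi (p j x) * f x))
   (1 + (c j * t) * A).
  apply: has_integralD; [exact: has_integral_density|exact: has_integralZ].
have le1 : 1 + (c j * t) * A <= expR (c j * y).
  apply: le_trans rle; apply: (le_has_integral hl hr) => x.
  apply: le_trans (ler_wpM2r (density_ge0 x df)
    (expR_ge1Dx (c j * (t * phi (p j x))))).
  move: (f x) => z; lra.
have yE : `|y| <= t * E.
  rewrite /y (le_trans (ler_normD _ _))// !normrM gtr0_norm//.
  rewrite normr_nat (gtr0_norm K0) /E mulrDr lerD2l -mulrA.
  rewrite ler_wpM2l ?(ltW tp)//.
  by rewrite expr2 ler_piMl// !mulr_ge0// ltW.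
have cy : c j * y <= 2^-1.
  apply: (le_trans (y := c j * (t * E))).
    by rewrite ler_wpM2l// (le_trans (ler_norm _)).
  have cE : 0 < 2 * c j * E by rewrite !mulr_gt0.
  by rewrite -(ler_pM2r cE) mulVf ?gt_eqF// in tE; lra.
have := le_trans le1 (expR_le_quadratic cy).
have : (c j * y) ^+ 2 <= (c j * E) ^+ 2 * t ^+ 2.
  rewrite -exprMn -(real_normK (num_real (c j * y))) lerXn2r ?nnegrE//.
    by rewrite !mulr_ge0// ltW.
  by rewrite normrM gtr0_norm// -mulrA ler_pM2l// [E * t]mulrC.
rewrite {2}/y => h1 h2; lra.
Qed.

Lemma extremal_marginal j : 0 < c j -> is_marginal mu (nu j) (p j) f (fj j).
Proof.
move=> cj; split => // phi mphi /bounded_fun_le[K hK].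
have df := is_density_extremal.
have [B hB] := has_integral_bounded mphi hK (density_integrable (dfj j)).
have mphip : measurable_fun setT (fun x => phi (p j x)).
  exact: measurableT_comp.
have [A hA] := has_integral_bounded mphip (fun x => hK (p j x))
  (density_integrable df).
rewrite hA.2 hB.2; congr (_%:E); apply/eqP; rewrite eq_le.
rewrite (extremal_marginal_le cj mphi hK hA hB) /=.
rewrite -lerN2; apply: (@extremal_marginal_le j (fun t => - phi t) K) => //.
- exact: measurableT_comp.
- by move=> t; rewrite normrN.
- have := has_integralZ (-1) hA; rewrite mulN1r.
  by under eq_fun do rewrite mulN1r -mulNr.
- have := has_integralZ (-1) hB; rewrite mulN1r.
  by under eq_fun do rewrite mulN1r -mulNr.
Qed.

(** * Equality in (BL): entropy of the extremal density *)

Hypothesis fefj : forall j : 'I_m, 0 < c j -> finite_entropy (nu j) (fj j).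

(** The bound [ln (1 + f) <= C + sum_j c_j ln (1 + f_j(p_j))] has only nonnegative terms; integrated
    against [f], its right side turns into the finite entropies of the marginals. *)
Lemma extremal_finite_entropy : finite_entropy mu f.
Proof.
have df := is_density_extremal.
have f0 x : 0 <= f x := density_ge0 x df.
have mf := density_measurable df.
pose v j x := c j * (ln (1 + fj j (p j x)) * f x).
have l0 j t : 0 <= ln (1 + fj j t) by rewrite ln_ge0// lerDl.
have ml j : measurable_fun setT (fun t => ln (1 + fj j t)).
  apply: (measurableT_comp (@measurable_ln R)); exact: measurable_funD.
have v0 j x : 0 <= v j x by rewrite mulr_ge0// mulr_ge0.
have mv j : measurable_fun setT (v j).
  do 2 apply: measurable_funM => //; apply: (measurableT_comp (ml j)) => //.
pose C := ln (1 + expR (- D)).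
have C0 : 0 <= C by rewrite ln_ge0// lerDl expR_ge0.
have key x : f x * ln (1 + f x) <= C * f x + \sum_j v j x.
  pose P := \prod_(j < m) (1 + fj j (p j x)) `^ c j.
  have b1 j : 1 <= 1 + fj j (p j x) by rewrite lerDl.
  have P1 : 1 <= P.
    apply: (big_ind (fun y => 1 <= y)) => [//|a b|j _]; first exact: mulr_ege1.
    rewrite -[X in X <= _](powRr0 (1 + fj j (p j x))); exact: ler_powR.
  have fP : bl_prod p c fj x <= P.
    apply: ler_prod => j _; rewrite powR_ge0 /=.
    apply: ge0_ler_powR; rewrite ?nnegrE//.
      exact: le_trans (b1 j).
    by rewrite lerDr.
  (* The summand 1 is absorbed by [P], which is at least 1. *)
  have h1 : 1 + f x <= (1 + expR (- D)) * P.
    by rewrite mulrDl mul1r lerD// /f ler_wpM2l ?expR_ge0.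
  have h2 : ln (1 + f x) <= C + \sum_j c j * ln (1 + fj j (p j x)).
    have Pp : 0 < P by exact: lt_le_trans P1.
    have Dp : 0 < 1 + expR (- D) :> R by rewrite addr_gt0 ?expR_gt0.
    have -> : \sum_j c j * ln (1 + fj j (p j x)) = ln P.
      rewrite ln_prod_gt0.
        by apply: eq_bigr => j _; rewrite ln_powR.
      by move=> j _; rewrite powR_gt0// (lt_le_trans _ (b1 j)).
    rewrite -lnM// ler_ln// posrE ?mulr_gt0//.
    by rewrite (lt_le_trans (ltr01 : 0 < 1 :> R))// lerDl.
  rewrite (le_trans (ler_wpM2l (f0 x) h2))// mulrDr [f x * C]mulrC lerD2l.
  by rewrite mulr_sumr; apply: ler_sum => j _; rewrite /v mulrCA [f x * _]mulrC.
apply: (@le_lt_trans _ _ (\int[mu]_x ((C * f x)%:E + \sum_j (v j x)%:E))%E).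
  apply: ge0_le_integral => //.
  - by move=> x _; rewrite lee_fin xln1Dx_ge0.
  - exact/measurable_EFinP/measurable_mul_ln1D.
  - apply: emeasurable_funD; first exact/measurable_EFinP/measurable_funM.
    by apply: emeasurable_sum => j; exact/measurable_EFinP.
  - by move=> x _; rewrite sumEFin -EFinD lee_fin.
rewrite ge0_integralD//; last 4 first.
- by move=> x _; rewrite lee_fin mulr_ge0.
- exact/measurable_EFinP/measurable_funM.
- by move=> x _; apply: sume_ge0 => j _; rewrite lee_fin.
- by apply: emeasurable_sum => j; exact/measurable_EFinP.
apply: lte_add_pinfty.
  by rewrite (has_integralZ C (has_integral_density df)).2 ltry.
have mvE j : measurable_fun setT (fun x => (v j x)%:E).
  exact/measurable_EFinP.
rewrite ge0_integral_sum//; last by move=> j x _; rewrite lee_fin.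
apply: lte_sum_pinfty => j _.
have := c_ge0 j; rewrite le_eqVlt => /predU1P[cj|cj].
  under eq_integral do rewrite /v -cj mul0r.
  by rewrite integral0 ltry.
under eq_integral do rewrite /v EFinM.
rewrite ge0_integralZl//; last 3 first.
- apply/measurable_EFinP/measurable_funM => //.
  exact: (measurableT_comp (ml j)).
- by move=> x _; rewrite lee_fin mulr_ge0.
- by rewrite lee_fin ltW.
rewrite lte_mul_pinfty ?lee_fin ?(ltW cj)//.
rewrite (marginal_ge0_integral (@p_meas j) df (extremal_marginal cj) (ml j))//.
by under eq_integral do rewrite mulrC; exact: fefj.
Qed.

Lemma extremal_entropy :
  weighted_entropy nu c fj = (entropy mu f + D%:E)%E.
Proof.
have df := is_density_extremal.
have f0 x : 0 <= f x := density_ge0 x df.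
have mf := density_measurable df.
pose u j x := c j * (ln (fj j (p j x)) * f x).
have ml j : measurable_fun setT (fun t => ln (fj j t)).
  exact: (measurableT_comp (@measurable_ln R)).
have mlf j : measurable_fun setT (fun x => ln (fj j (p j x)) * f x).
  by apply: measurable_funM => //; exact: (measurableT_comp (ml j)).
have mu_ j : measurable_fun setT (u j) by exact: measurable_funM.
have maxMl (a b : R) : 0 <= b -> Num.max (a * b) 0 = Num.max a 0 * b.
  by move=> b0; rewrite maxr_pMl// mul0r.
have iu0 j : 0 < c j ->
    (\int[mu]_x (Num.max (ln (fj j (p j x)) * f x) 0)%:E < +oo)%E.
  move=> cj; under eq_integral do rewrite maxMl//.
  rewrite (marginal_ge0_integral (@p_meas j) df (extremal_marginal cj)
    (psi := fun t => Num.max (ln (fj j t)) 0)).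
  - under eq_integral do rewrite -maxMl// mulrC.
    exact: finite_entropy_funepos_lty (fefj cj).
  - exact: measurable_maxr.
  - by move=> t; rewrite le_max lexx orbT.
have iu j : (\int[mu]_x (Num.max (u j x) 0)%:E < +oo)%E.
  have := c_ge0 j; rewrite le_eqVlt => /predU1P[cj|cj].
    under eq_integral do rewrite /u -cj mul0r maxxx.
    by rewrite integral0 ltry.
  have maxMr (b : R) : Num.max (c j * b) 0 = c j * Num.max b 0.
    by rewrite maxr_pMr// mulr0.
  under eq_integral do rewrite /u maxMr EFinM.
  rewrite ge0_integralZl//.
  - by rewrite lte_mul_pinfty ?lee_fin ?(ltW cj)//; exact: iu0.
  - by apply/measurable_EFinP; exact: measurable_maxr.
  - by move=> x _; rewrite lee_fin le_max lexx orbT.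
  - by rewrite lee_fin ltW.
(* For [c j = 0] nothing identifies [fj j] as a marginal, but both sides are 0 even if the entropy
   is infinite. *)
have eu j : (\int[mu]_x (u j x)%:E = (c j)%:E * entropy (nu j) (fj j))%E.
  have := c_ge0 j; rewrite le_eqVlt => /predU1P[cj|cj].
    under eq_integral do rewrite /u -cj mul0r.
    by rewrite -cj mul0e integral0.
  rewrite (integralZl_funepos_lty (ltW cj) (mlf j) (iu0 _ cj)).
  by rewrite (marginal_entropy (@p_meas j) df (extremal_marginal cj)).
have hD := has_integralZ (- D) (has_integral_density df).
have [sum_lty sumE] := integral_sum_funepos_lty (index_enum 'I_m) mu_ iu.
(* This holds at every point: where [f] vanishes both integrands are 0, and elsewhere a nonzero
   product forces [fj j > 0] for every [j] with [c j > 0]. *)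
have -> : entropy mu f = (\int[mu]_x (\sum_j u j x + - D * f x)%:E)%E.
  apply: eq_integral => x _; congr (_%:E).
  have [fx0|fx0] := eqVneq (f x) 0.
    rewrite fx0 mul0r mulr0 addr0 big1// => j _.
    by rewrite /u fx0 !mulr0.
  have bx : bl_prod p c fj x != 0.
    by apply: contra_neq fx0 => b0; rewrite /f b0 mulr0.
  have gx j : 0 < c j -> 0 < fj j (p j x).
    move=> cj; rewrite lt_def fj0 andbT; apply: contra_neq bx => g0.
    by rewrite /bl_prod (bigD1 j)//= g0 powR0 ?gt_eqF// mul0r.
  rewrite {2}/f lnM ?posrE ?expR_gt0//; last exact: bl_prod_gt0.
  rewrite expRK ln_bl_prod// mulrDr addrC [f x * - D]mulrC; congr (_ + _).
  by rewrite mulr_sumr; apply: eq_bigr => j _; rewrite /u; ring.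
rewrite integralD_funepos_lty//; last 3 first.
- exact: measurable_sum.
- exact: measurable_funM.
- have := integral_funepos_lt_pinfty measurableT hD.1.
  by have := EFin_funepos (fun x => - D * f x) => ->.
rewrite hD.2 mulr1 EFinN subeK// sumE /weighted_entropy.
by apply: eq_bigr => j _; rewrite eu.
Qed.

(** Any other version of a marginal agrees with [fj j] almost everywhere, so it has the same
    entropy. *)
Lemma extremal_entropy_marginals (g : forall j, M j -> R) :
  (forall j, 0 < c j -> is_marginal mu (nu j) (p j) f (g j)) ->
  weighted_entropy nu c g = (entropy mu f + D%:E)%E.
Proof.
move=> fg; rewrite -extremal_entropy; apply: eq_bigr => j _.
have := c_ge0 j; rewrite le_eqVlt => /predU1P[<-|cj]; first by rewrite !mul0e.
congr (_ * _)%E; apply: entropy_ae_eq => //.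
- exact: density_measurable (fg j cj).1.
- exact: (marginal_unique (fg j cj) (extremal_marginal cj)).
Qed.

End brascamp_lieb.

Unset Implicit Arguments.
Set Strict Implicit.

Theorem theorem2p2 (R : realType)
  (d : measure_display) (Omega : measurableType d)
  (mu : {measure set Omega -> \bar R})
  (m : nat) (m_gt0 : (0 < m)%N)
  (dM : 'I_m -> measure_display)
  (M : forall j : 'I_m, measurableType (dM j))
  (nu : forall j : 'I_m, {measure set (M j) -> \bar R})
  (p : forall j : 'I_m, Omega -> M j)
  (p_meas : forall j : 'I_m, measurable_fun setT (p j))
  (c : 'I_m -> R) (c_ge0 : forall j : 'I_m, 0 <= c j) (D : R)
  (BL : brascamp_lieb mu nu p c D)
  (SA : subadditivity mu nu p c D) :
  (* (i): the premise that [entropy mu f] is not -oo excludes the degenerate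
     equality -oo = -oo *)
  (forall (f : Omega -> R) (g : forall j : 'I_m, M j -> R),
     is_density mu f -> finite_entropy mu f -> entropy mu f <> -oo%E ->
     (forall j : 'I_m, is_marginal mu (nu j) (p j) f (g j)) ->
     weighted_entropy nu c g = (entropy mu f + D%:E)%E ->
     bl_lhs mu p c g = bl_rhs nu c D g /\
     {ae mu, forall x, f x = expR (- D) * bl_prod p c g x})
  /\
  (* (ii): a coordinate with [c j = 0] occurs neither in the equality case of
     (BL) nor in (S); the entropies in (S) must be defined *)
  (forall fj : forall j : 'I_m, M j -> R,
     (forall j : 'I_m, is_density (nu j) (fj j)) ->
     bl_lhs mu p c fj = bl_rhs nu c D fj ->
     let f := fun x : Omega => expR (- D) * bl_prod p c fj x in
     [/\ is_density mu f,
         (forall j : 'I_m, 0 < c j -> is_marginal mu (nu j) (p j) f (fj j)) &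
         ((forall j : 'I_m, 0 < c j -> finite_entropy (nu j) (fj j)) ->
          finite_entropy mu f /\
          (forall g : forall j : 'I_m, M j -> R,
             (forall j : 'I_m, 0 < c j ->
                is_marginal mu (nu j) (p j) f (g j)) ->
             weighted_entropy nu c g = (entropy mu f + D%:E)%E))]).
Proof.
split=> [f g df fe fNy fg eqS|fj dfj BLeq f].
  exact: (entropy_equality_case p_meas c_ge0 BL).
split; first exact: is_density_extremal.
- by move=> j cj; exact: (extremal_marginal p_meas c_ge0 BL).
- move=> fefj; split; first exact: (extremal_finite_entropy p_meas c_ge0 BL).
  exact: (extremal_entropy_marginals p_meas c_ge0 BL).
Qed.
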